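(* For $m\ge 0$ let $r(m)$ be the number of $\approx$-equivalence classes of two-layer comparator networks on $m$ channels whose first layer is $F_m=\{(2i-1,2i):1\le i\le\lfloor m/2\rfloor\}$ (so $r(0)=1$, the empty network). Then for every $n\ge 2$, the number of $\approx$-equivalence classes of redundant two-layer comparator networks on $n$ channels with first layer $F_n$ equals $r(n-2)$.
   Context: A comparator network on $n$ channels is a sequence of layers; each layer is a set of comparators $(i,j)$, $1\le i<j\le n$, with each channel in at most one comparator of the layer. On an input, comparator $(i,j)$ places the minimum of the values on channels $i,j$ on channel $i$ and the maximum on channel $j$; untouched channels keep their values. For a network $C$, $\mathrm{outputs}(C)=\{C(\vec x):\vec x\in\{0,1\}^n\}$. For a permutation $\pi$ of $\{1,\ldots,n\}$ and $\vec x\in\{0,1\}^n$, $\pi(\vec x)$ is the vector $\vec y$ with $y_{\pi(i)}=x_i$, and $\pi$ acts elementwise on sets of vectors. A comparator network $C$ is redundant if there is a network $C'$ obtained from $C$ by removing one comparator such that $\mathrm{outputs}(C')=\pi(\mathrm{outputs}(C))$ for some permutation $\pi$. Graph representation: $\mathcal G(C)$ has one vertex per comparator; for a comparator $u$ in layer $k$ and a comparator $v$ in a later layer, there is an edge labeled $1$ (resp. $2$) from $u$ to $v$ if the smaller (resp. larger) channel of $u$ is used by $v$ and by no comparator in a layer strictly between. $C_1\approx C_2$ means $\mathcal G(C_1)$ and $\mathcal G(C_2)$ are isomorphic as edge-labeled directed graphs. *)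

(* Defs.v *)
(* MathComp.  Channels 1, ..., n are represented by the ordinals 0, ..., n-1. *)
From mathcomp Require Import all_boot all_order all_fingroup.

Set Implicit Arguments.
Unset Strict Implicit.
Unset Printing Implicit Defensive.

Import Order.TTheory.

Definition comparator (n : nat) := ('I_n * 'I_n)%type.

Definition uses n (c : comparator n) (i : 'I_n) : bool :=
  (i == c.1) || (i == c.2).

Definition layer (n : nat) := {set comparator n}.

Definition is_layer n (L : layer n) : bool :=
  [forall c in L, c.1 < c.2] && [forall i, #|[set c in L | uses c i]| <= 1].

Definition network (n : nat) := seq (layer n).

Definition is_network n (C : network n) : bool := all (@is_layer n) C.

Definition apply_layer n d (T : orderType d) (x : {ffun 'I_n -> T})
    (L : layer n) : {ffun 'I_n -> T} :=
  [ffun i => if [pick c in L | uses c i] is Some c then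
               if i == c.1 then Order.min (x c.1) (x c.2)
               else Order.max (x c.1) (x c.2)
             else x i].

Definition run n d (T : orderType d) (C : network n) (x : {ffun 'I_n -> T}) :
    {ffun 'I_n -> T} :=
  foldl (@apply_layer n d T) x C.

(* bool carries the order false < true. *)
Definition outputs n (C : network n) : {set {ffun 'I_n -> bool}} :=
  [set run C x | x : {ffun 'I_n -> bool}].

Definition permute n (s : 'S_n) (x : {ffun 'I_n -> bool}) :
    {ffun 'I_n -> bool} :=
  [ffun j => x ((s^-1)%g j)].

Lemma permuteE n (s : 'S_n) (x : {ffun 'I_n -> bool}) (i : 'I_n) :
  permute s x (s i) = x i.
Proof. by rewrite ffunE permK. Qed.

(* The occurrences of comparators in C: a layer index, and a comparator of
   that layer. *)
Definition vertex n (C : network n) :=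
  {v : 'I_(size C) * comparator n | v.2 \in nth set0 C v.1}.

Definition vlayer n (C : network n) (v : vertex C) : nat := (val v).1.
Definition vcomp n (C : network n) (v : vertex C) : comparator n := (val v).2.

Definition remove n (C : network n) (v : vertex C) : network n :=
  set_nth set0 C (vlayer v) (nth set0 C (vlayer v) :\ vcomp v).

Definition redundant n (C : network n) : bool :=
  [exists v : vertex C, exists s : 'S_n,
    outputs (remove v) == permute s @: outputs C].

(* Edges of the graph of C.  The label false stands for 1 (smaller channel) and
   true for 2 (larger channel); a pair of vertices may carry both labels. *)
Definition edge n (C : network n) (b : bool) (u v : vertex C) : bool :=
  let i := if b then (vcomp u).2 else (vcomp u).1 in
  [&& vlayer u < vlayer v, uses (vcomp v) i &
    [forall w : vertex C,
      (vlayer u < vlayer w < vlayer v) ==> ~~ uses (vcomp w) i]].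

Definition net_equiv n (C1 C2 : network n) : bool :=
  [exists f : {ffun vertex C1 -> vertex C2},
    [exists g : {ffun vertex C2 -> vertex C1},
      [forall u, g (f u) == u] && [forall v, f (g v) == v]] &&
    [forall b, forall u, forall v, edge b u v == edge b (f u) (f v)]].

Lemma net_equivP n (C1 C2 : network n) :
  reflect (exists f : vertex C1 -> vertex C2,
             bijective f /\ forall b u v, edge b u v = edge b (f u) (f v))
          (net_equiv C1 C2).
Proof.
apply: (iffP existsP) =>
  [[f /andP[/existsP[g /andP[/forallP gK /forallP fK]] /forallP E]]|[f [[g gK fK] E]]].
  exists f; split; last by move=> b u v; move/forallP/(_ u)/forallP/(_ v)/eqP: (E b).
  by exists g => x; apply/eqP.
exists [ffun u => f u]; apply/andP; split.
  apply/existsP; exists [ffun v => g v].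
  by apply/andP; split; apply/forallP => x; rewrite !ffunE ?gK ?fK.
by do 3![apply/forallP => ?]; rewrite !ffunE E.
Qed.

Lemma net_equiv_refl n (C : network n) : net_equiv C C.
Proof. by apply/net_equivP; exists id; split=> //; exists id. Qed.

Lemma net_equiv_sym n (C1 C2 : network n) :
  net_equiv C1 C2 -> net_equiv C2 C1.
Proof.
case/net_equivP=> f [[g gK fK] E]; apply/net_equivP; exists g.
by split=> [|b u v]; [exists f | rewrite E !fK].
Qed.

Lemma net_equiv_trans n (C1 C2 C3 : network n) :
  net_equiv C1 C2 -> net_equiv C2 C3 -> net_equiv C1 C3.
Proof.
case/net_equivP=> f [bf Ef] /net_equivP[g [bg Eg]]; apply/net_equivP.
by exists (g \o f); split=> [|b u v]; [exact: bij_comp | rewrite Ef Eg].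
Qed.

Definition first_layer (n : nat) : layer n :=
  [set c : comparator n |
    [exists i : 'I_n./2, (c.1 == i.*2 :> nat) && (c.2 == i.*2.+1 :> nat)]].

Definition two_layer (n : nat) : {set 2.-tuple (layer n)} :=
  [set C : 2.-tuple (layer n) |
    is_network C && (tnth C ord0 == first_layer n)].

Definition num_classes n (D : {set 2.-tuple (layer n)}) : nat :=
  #|equivalence_partition (fun C1 C2 : 2.-tuple (layer n) => net_equiv C1 C2) D|.

Definition r (m : nat) : nat := num_classes (two_layer m).

Lemma is_layer_first n : is_layer (first_layer n).
Proof.
apply/andP; split.
  apply/forall_inP => c; rewrite inE => /existsP[i /andP[/eqP -> /eqP ->]].
  exact: ltnSn.
apply/forallP => k; apply/card_le1_eqP => -[a b] [a' b'].
rewrite !inE /uses /= => /andP[/existsP[i /andP[/eqP ai /eqP bi]] ki].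
case/andP=> /existsP[j /andP[/eqP aj /eqP bj]] kj.
have half_eq (i0 : nat) (a0 b0 : 'I_n) : a0 = i0.*2 :> nat ->
    b0 = i0.*2.+1 :> nat -> (k == a0) || (k == b0) -> k./2 = i0.
  by move=> ea eb /orP[]/eqP->; rewrite ?ea ?eb ?uphalf_double ?doubleK //= uphalf_double.
have eij : i = j :> nat by rewrite -(half_eq _ _ _ ai bi ki) (half_eq _ _ _ aj bj kj).
by congr pair; apply: val_inj; rewrite /= ?ai ?aj ?bi ?bj eij.
Qed.

Lemma r0 : r 0 = 1.
Proof.
have all_eq (C : 2.-tuple (layer 0)) : C = [tuple set0; set0].
  apply: eq_from_tnth => k; apply/setP => -[[? []]] //.
apply/eqP/cards1P; exists [set: 2.-tuple (layer 0)].
apply/setP => A; rewrite inE; apply/imsetP/eqP => [[C CD ->]|->].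
  by apply/setP => D; rewrite !inE (all_eq D) -(all_eq C) net_equiv_refl andbT; move: CD; rewrite inE.
have D0 : [tuple set0; set0] \in two_layer 0.
  rewrite inE /is_network /=.
  have e (L : layer 0) : L = first_layer 0 by apply/setP => -[[? []]].
  by rewrite [X in X == _]e eqxx (e set0) !is_layer_first.
exists [tuple set0; set0] => //.
by apply/setP => D; rewrite in_setT inE (all_eq D) D0 net_equiv_refl.
Qed.

(* Main.v *)
(**
A two-layer network whose layers share a comparator is redundant: the second
copy does nothing.  Otherwise removing a comparator c enlarges the set of
outputs, so no permutation can match the two sets.  If c = (i, j) is in the
second layer, c merges two outputs of the remaining network that differ by
exchanging the values of i and j.  If c is in the first layer, the outputs only
grow, and an input putting 1 on the smaller channel a and 0 on the larger
channel b of c, with suitable values on the channels that the second layer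
compares with them, gives an output that cannot be reached when a <= b.

So a network is redundant iff its graph has a component consisting of two
vertices joined by edges with both labels.  Deleting the two channels of such a
component is an order-preserving relabelling of the other channels onto those
of F_(n-2), and isomorphism classes of finite graphs allow a common component to
be cancelled, which gives the bijection of classes with the networks on n - 2
channels.
*)
Require Import Defs.
From mathcomp Require Import all_boot all_order all_fingroup.

Set Implicit Arguments.
Unset Strict Implicit.
Unset Printing Implicit Defensive.

(** * Action of a layer on Boolean inputs *)

Lemma is_layerP n (L : layer n) :
  reflect ((forall c, c \in L -> c.1 < c.2) /\
           (forall i c c', c \in L -> c' \in L -> uses c i -> uses c' i ->
              c = c'))
          (is_layer L).
Proof.
apply: (iffP andP) => [[/forall_inP lt /forallP le1]|[lt le1]]; split=> //.
- move=> i c c' cL c'L ci c'i; move/card_le1_eqP: (le1 i).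
  by apply; rewrite inE ?cL ?c'L.
- exact/forall_inP.
apply/forallP => i; apply/card_le1_eqP => c c'.
by rewrite !inE => /andP[cL ci] /andP[c'L c'i]; apply: (le1 i).
Qed.

Lemma is_layerS n (A B : layer n) : A \subset B -> is_layer B -> is_layer A.
Proof.
move=> /subsetP sAB /is_layerP[lt le1]; apply/is_layerP; split.
  by move=> c /sAB; apply: lt.
by move=> i c c' /sAB cB /sAB; apply: le1.
Qed.

Lemma apply_layer_in n (L : layer n) c (x : {ffun 'I_n -> bool}) :
  is_layer L -> c \in L ->
  apply_layer x L c.1 = x c.1 && x c.2 /\ apply_layer x L c.2 = x c.1 || x c.2.
Proof.
move=> /is_layerP[lt le1] cL; have lt12 := lt c cL.
have ne21 : c.2 == c.1 = false by apply/negbTE; rewrite neq_ltn lt12 orbT.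
have pickE i : uses c i -> [pick c' in L | uses c' i] = Some c.
  move=> ci; case: pickP => [c' /andP[c'L c'i]|/(_ c)]; last by rewrite cL ci.
  by congr Some; apply: (le1 i).
rewrite !ffunE !pickE /uses ?eqxx ?orbT // ne21.
by split; case: (x c.1); case: (x c.2).
Qed.

Lemma apply_layer_out n (L : layer n) i (x : {ffun 'I_n -> bool}) :
  (forall c, c \in L -> ~~ uses c i) -> apply_layer x L i = x i.
Proof.
move=> out; rewrite ffunE; case: pickP => // c /andP[/out/negbTE->] //.
Qed.

Variant channel_spec n (L : layer n) : 'I_n -> Prop :=
| ChannelMin c of c \in L : channel_spec L c.1
| ChannelMax c of c \in L : channel_spec L c.2
| ChannelFree i of (forall c, c \in L -> ~~ uses c i) : channel_spec L i.

Lemma channelP n (L : layer n) i : channel_spec L i.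
Proof.
case: (pickP [pred c in L | uses c i]) => [c /andP[cL /orP[]/eqP->]|out].
- exact: ChannelMin.
- exact: ChannelMax.
by apply: ChannelFree => c cL; have := out c; rewrite /= cL => /negbT.
Qed.

Lemma apply_layer_id n (L : layer n) (x : {ffun 'I_n -> bool}) :
  is_layer L -> (forall c, c \in L -> x c.1 -> x c.2) -> apply_layer x L = x.
Proof.
move=> lL srt; apply/ffunP => i.
case: (channelP L i) => [c cL|c cL|j /apply_layer_out->//].
  have [-> _] := apply_layer_in x lL cL; have := srt c cL.
  by case: (x c.1) => // ->.
have [_ ->] := apply_layer_in x lL cL; have := srt c cL.
by case: (x c.1) => // ->.
Qed.

Lemma apply_layer_sorted n (L : layer n) c (x : {ffun 'I_n -> bool}) :
  is_layer L -> c \in L -> apply_layer x L c.1 -> apply_layer x L c.2.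
Proof.
by move=> lL cL; have [-> ->] := apply_layer_in x lL cL; case/andP=> ->.
Qed.

Lemma apply_layerD1_out n (L : layer n) c i (x : {ffun 'I_n -> bool}) :
  is_layer L -> c \in L -> uses c i -> apply_layer x (L :\ c) i = x i.
Proof.
move=> /is_layerP[_ le1] cL ci; apply: apply_layer_out => c'.
rewrite !inE => /andP[/eqP ne c'L]; apply/negP => c'i; apply: ne.
exact: (le1 i).
Qed.

(** Comparators of a layer act on disjoint channels, so [c] may be performed after all the
    others. *)
Lemma apply_layerD1 n (L : layer n) c (x : {ffun 'I_n -> bool}) :
  is_layer L -> c \in L ->
  apply_layer (apply_layer x (L :\ c)) [set c] = apply_layer x L.
Proof.
move=> lL cL.
have lD : is_layer (L :\ c) := is_layerS (subD1set L c) lL.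
have l1 : is_layer [set c] by apply: is_layerS lL; rewrite sub1set.
have use1 : uses c c.1 by rewrite /uses eqxx.
have use2 : uses c c.2 by rewrite /uses eqxx orbT.
have [m1 m2] := apply_layer_in (apply_layer x (L :\ c)) l1 (set11 c).
have [n1 n2] := apply_layer_in x lL cL.
apply/ffunP => i; have [ci|nci] := boolP (uses c i).
  case/orP: ci => /eqP->.
    by rewrite m1 n1 !(apply_layerD1_out _ lL cL).
  by rewrite m2 n2 !(apply_layerD1_out _ lL cL).
rewrite [LHS]apply_layer_out; last by move=> c' /set1P->.
move: nci; case: (channelP L i) => [c' c'L|c' c'L|j out] nci.
- have c'D : c' \in L :\ c.
    by rewrite !inE c'L andbT; apply: contraNneq nci => ->.
  have [-> _] := apply_layer_in x lD c'D.
  by have [-> _] := apply_layer_in x lL c'L.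
- have c'D : c' \in L :\ c.
    by rewrite !inE c'L andbT; apply: contraNneq nci => ->.
  have [_ ->] := apply_layer_in x lD c'D.
  by have [_ ->] := apply_layer_in x lL c'L.
rewrite !apply_layer_out // => c'; rewrite !inE => /andP[_]; exact: out.
Qed.

Lemma first_layerE n (c : comparator n) :
  (c \in first_layer n) = ~~ odd c.1 && (c.2 == c.1.+1 :> nat).
Proof.
rewrite inE; apply/existsP/andP => [[i /andP[/eqP-> /eqP->]]|[ev /eqP e2]].
  by rewrite odd_double.
have e1 : c.1 = c.1./2.*2 :> nat by rewrite even_halfK.
have lt : c.1./2 < n./2.
  rewrite -ltn_double -e1.
  have := ltn_ord c.2; rewrite e2 => lt2.
  rewrite -ltnS; apply: leq_trans lt2 _.
  by rewrite -[X in X <= _]odd_double_half -add1n leq_add2r; case: odd.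
by exists (Ordinal lt); rewrite /= -e1 e2 !eqxx.
Qed.

(** Here [c] is the partner of [a] in [L], or [a] itself when [L] leaves [a] untouched. Conjunction
    and disjunction over a compared pair are invariant, which spares a case distinction on which of
    the two channels is smaller. *)
Lemma mate n (L : layer n) (a : 'I_n) : is_layer L ->
  exists c : 'I_n,
    [/\ c != a -> exists2 l, l \in L & l = (a, c) \/ l = (c, a),
        forall x, apply_layer x L a && apply_layer x L c = x a && x c &
        forall x, apply_layer x L a || apply_layer x L c = x a || x c].
Proof.
move=> lL; case: (channelP L a) => [l lin|l lin|{}a out].
- exists l.2; split=> [_|x|x]; first by exists l => //; left; case: (l).
    by have [-> ->] := apply_layer_in x lL lin; case: (x l.1); case: (x l.2).
  by have [-> ->] := apply_layer_in x lL lin; case: (x l.1); case: (x l.2).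
- exists l.1; split=> [_|x|x]; first by exists l => //; right; case: (l).
    by have [-> ->] := apply_layer_in x lL lin; case: (x l.1); case: (x l.2).
  by have [-> ->] := apply_layer_in x lL lin; case: (x l.1); case: (x l.2).
by exists a; split=> [|x|x]; rewrite ?eqxx ?apply_layer_out.
Qed.

(** * Outputs after the removal of a comparator *)

Lemma outputs_two n (A L : layer n) (z : {ffun 'I_n -> bool}) :
  reflect (exists x, z = apply_layer (apply_layer x A) L)
          (z \in outputs [:: A; L]).
Proof.
by apply: (iffP imsetP) => [[x _ ->]|[x ->]]; exists x.
Qed.

(** Performing [c] last maps the outputs of the reduced network onto those of the full one; it
    remains to find two outputs that this map identifies. *)
Lemma card_outputs_remove2 n (L : layer n) c :
  is_layer L -> c \in L -> c \notin first_layer n ->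
  #|outputs [:: first_layer n; L]| < #|outputs [:: first_layer n; L :\ c]|.
Proof.
move=> lL cL cF; have [ltL le1] := is_layerP _ lL.
have lF := is_layer_first n; have lD := is_layerS (subD1set L c) lL.
have lt12 := ltL c cL.
have ne21 : c.2 == c.1 = false by apply/negbTE; rewrite neq_ltn lt12 orbT.
have use1 : uses c c.1 by rewrite /uses eqxx.
have use2 : uses c c.2 by rewrite /uses eqxx orbT.
pose h z := apply_layer z [set c] : {ffun 'I_n -> bool}.
have -> : outputs [:: first_layer n; L] =
    h @: outputs [:: first_layer n; L :\ c].
  apply/setP => z.
  apply/outputs_two/imsetP => [[x ->]|[y /outputs_two[x ->] ->]].
    exists (apply_layer (apply_layer x (first_layer n)) (L :\ c)).
      by apply/outputs_two; exists x.
    by rewrite /h apply_layerD1.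
  by exists x; rewrite /h apply_layerD1.
rewrite ltn_neqAle leq_imset_card andbT; apply/imset_injP => inj.
(* The default [odd t] puts 0 on the smaller and 1 on the larger channel of each first-layer pair.
   Since [c] is not such a pair, it changes at most one channel of each, so the pair stays sorted
   for either [s]. *)
pose y (s : bool) : {ffun 'I_n -> bool} :=
  [ffun t : 'I_n => if t == c.1 then s else if t == c.2 then ~~ s else odd t].
have yF s : apply_layer (y s) (first_layer n) = y s.
  apply: apply_layer_id => // -[p q] pqF; move: (pqF).
  rewrite first_layerE !ffunE /= => /andP[/negbTE podd /eqP eq].
  have qodd : odd q by rewrite eq /= podd.
  case: (eqVneq p c.1) => [p1|_].
    rewrite (_ : q == c.1 = false); last first.
      by rewrite -p1 -val_eqE /= eq eqn_leq ltnn.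
    case: (eqVneq q c.2) => [q2|_]; last by rewrite qodd.
    by case/negP: cF; rewrite [c]surjective_pairing -p1 -q2.
  case: (eqVneq p c.2) => [p2|_]; last by rewrite podd.
  rewrite (_ : q == c.1 = false).
    by rewrite (_ : q == c.2 = false) ?qodd // -p2 -val_eqE /= eq eqn_leq ltnn.
  by rewrite -val_eqE /= gtn_eqF // eq p2; apply: leqW.
have zO s : apply_layer (y s) (L :\ c) \in outputs [:: first_layer n; L :\ c].
  by apply/outputs_two; exists (y s); rewrite yF.
(* The inputs [y true] and [y false] differ only by exchanging the values on the channels of [c], so
   [L] sends them to the same vector; injectivity would make them agree already before [c] acts. *)
have e : apply_layer (y true) (L :\ c) = apply_layer (y false) (L :\ c).
  apply: inj; rewrite // /h !apply_layerD1 //.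
  have yE i : ~~ uses c i -> y true i = y false i.
    by rewrite /uses !ffunE; case: eqP => // _; case: eqP.
  have away c' i : c' \in L -> c' != c -> uses c' i -> ~~ uses c i.
    move=> c'L ne c'i; apply/negP => ci; case/eqP: ne; exact: (le1 i).
  have cE : apply_layer (y true) L c.1 = apply_layer (y false) L c.1 /\
            apply_layer (y true) L c.2 = apply_layer (y false) L c.2.
    have [-> ->] := apply_layer_in (y true) lL cL.
    have [-> ->] := apply_layer_in (y false) lL cL.
    by rewrite !ffunE !eqxx ne21.
  apply/ffunP => i; case: (channelP L i) => [c' c'L|c' c'L|{}i out].
  - have [->|ne] := eqVneq c' c; first by case: cE.
    have [-> _] := apply_layer_in (y true) lL c'L.
    have [-> _] := apply_layer_in (y false) lL c'L.
    by rewrite !yE // (away c') // /uses eqxx ?orbT.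
  - have [->|ne] := eqVneq c' c; first by case: cE.
    have [_ ->] := apply_layer_in (y true) lL c'L.
    have [_ ->] := apply_layer_in (y false) lL c'L.
    by rewrite !yE // (away c') // /uses eqxx ?orbT.
  by rewrite !apply_layer_out // yE // out.
move/ffunP/(_ c.1): e.
by rewrite !(apply_layerD1_out _ lL cL) // !ffunE eqxx.
Qed.

Lemma card_outputs_remove1 n (L : layer n) e :
  is_layer L -> e \in first_layer n -> e \notin L ->
  #|outputs [:: first_layer n; L]| < #|outputs [:: first_layer n :\ e; L]|.
Proof.
case: e => a b lL eF eL; have [ltL le1] := is_layerP _ lL.
have lF := is_layer_first n; have lD := is_layerS (subD1set _ (a, b)) lF.
have := eF; rewrite first_layerE /= => /andP[aev /eqP bE].
have bodd : odd b by rewrite bE.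
have neab : a != b by apply: contraNneq aev => ->.
have e'L : (b, a) \notin L.
  by apply/negP => /ltL /=; rewrite bE ltnNge leqnSn.
have [c [cL candE corE]] := mate a lL; have [d [dL dandE dorE]] := mate b lL.
have necb : c != b.
  apply/eqP => cb; move: cL; rewrite cb eq_sym => /(_ neab)[l lin].
  by case=> e; move: lin; rewrite e ?(negPf eL) ?(negPf e'L).
have neda : d != a.
  apply/eqP => da; move: dL; rewrite da => /(_ neab)[l lin].
  by case=> e; move: lin; rewrite e ?(negPf eL) ?(negPf e'L).
have necd : c != d.
  apply/eqP => cd; rewrite -cd in dL neda.
  have [l lin le] := cL neda; have [l' l'in l'e] := dL necb.
  have ll' : l = l'.
    apply: (le1 c) => //; first by case: le => ->; rewrite /uses /= eqxx ?orbT.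
    by case: l'e => ->; rewrite /uses /= eqxx ?orbT.
  move/eqP: neab; move/eqP: necb; rewrite -{}ll' in l'e.
  by case: le => -> in l'e; case: l'e => -[]; congruence.
(* The default value odd t sorts the pairs of the first layer.  If c and d form
   such a pair, c cannot carry 1 while d carries 0: hence the value at c. *)
pose w : {ffun 'I_n -> bool} := [ffun t : 'I_n =>
  if t == a then true else if (t == b) || (t == d) then false
  else if t == c then (c, d) \notin first_layer n else odd t].
have wF : apply_layer w (first_layer n :\ (a, b)) = w.
  apply: apply_layer_id => // -[p q]; rewrite in_setD1 => /andP[ne pqF].
  move: (pqF); rewrite first_layerE /= => /andP[pev /eqP qE].
  have qodd : odd q by rewrite qE.
  have nepa : p != a.
    apply: contraNneq ne => pa; rewrite pa; apply/eqP; congr pair.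
    by apply: val_inj; rewrite /= qE bE pa.
  have nepb : p != b by apply: contraNneq pev => ->.
  have neqb : q != b.
    apply: contraNneq nepa => qb; apply/eqP/val_inj/eqP.
    by rewrite -eqSS -qE -bE qb.
  have neqa : q != a by apply: contraNneq aev => <-.
  rewrite !ffunE (negPf nepa) (negPf nepb) (negPf neqa) (negPf neqb) /=.
  rewrite (negPf pev).
  case: (eqVneq p d) => // _; case: (eqVneq p c) => // pc; rewrite -pc => ncd.
  rewrite (_ : q == d = false); last by apply: contraNF ncd => /eqP <-.
  rewrite (_ : q == p = false) //; apply/negbTE.
  by apply: contraNneq pev => <-.
apply: proper_card; apply/properP; split.
  (* Inclusion: feed the reduced network the vector already sorted by the whole first layer, which
     the remaining comparators leave fixed. *)
  apply/subsetP => z /outputs_two[x ->]; apply/outputs_two.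
  exists (apply_layer x (first_layer n)); congr apply_layer.
  rewrite [RHS]apply_layer_id // => f; rewrite in_setD1 => /andP[_].
  exact: apply_layer_sorted.
exists (apply_layer w L); first by apply/outputs_two; exists w; rewrite wF.
apply/outputs_two => -[x]; set y := apply_layer x _ => wy.
have wa : w a by rewrite ffunE eqxx.
(* As [w] is 0 at [b] and [d], the invariant disjunction makes [y] 0 at both; sortedness of [y] on
   [(a, b)] then gives 0 at [a]. *)
have := dorE w; rewrite wy dorE.
have -> : w b = false by rewrite ffunE eqxx eq_sym (negPf neab).
have -> : w d = false by rewrite ffunE eqxx orbT (negPf neda).
move/norP => [yb yd].
have ya : y a = false.
  by apply: contraNF yb => /(apply_layer_sorted lF eF).
(* If [(c, d)] is a first-layer pair, the disjunction over [a] and [c] forces [y c], hence [y d].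
   Otherwise [w] is 1 at both [a] and [c], and their conjunction forces [y a]. *)
have [cdF|cdF] := boolP ((c, d) \in first_layer n).
  have := corE w; rewrite wy corE wa ya /= => yc.
  by case/negP: yd; exact: (apply_layer_sorted lF cdF yc).
have := candE w; rewrite wy candE ya wa /= ffunE.
by rewrite (negPf necb) (negPf necd) eqxx cdF; case: ifP.
Qed.

Lemma vertexP n (C : network n) i c :
  i < size C -> c \in nth set0 C i ->
  exists v : vertex C, vlayer v = i /\ vcomp v = c.
Proof.
move=> lt cC; pose p : 'I_(size C) * comparator n := (Ordinal lt, c).
by exists (exist _ p cC).
Qed.

(** A permutation preserves the number of outputs, which strictly grows when the removed comparator
    is not shared. For a shared one, the second-layer copy is removed and the identity permutation
    serves. *)
Lemma redundantE n (L : layer n) : is_layer L ->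
  redundant [:: first_layer n; L] = [exists c in first_layer n, c \in L].
Proof.
move=> lL; apply/existsP/exists_inP => [[v /existsP[s /eqP eqO]]|[c cF cL]].
  have card_perm : #|permute s @: outputs [:: first_layer n; L]| =
                   #|outputs [:: first_layer n; L]|.
    apply: card_imset => x y /ffunP exy; apply/ffunP => i.
    by have := exy (s i); rewrite !permuteE.
  have vC : vcomp v \in nth set0 [:: first_layer n; L] (vlayer v) := valP v.
  move: eqO card_perm; rewrite /remove.
  have : vlayer v < 2 := ltn_ord (val v).1.
  move: vC; case: (vlayer v) => [|[|]] //= vC _ eqO; rewrite -eqO => card_eq.
    exists (vcomp v) => //; apply: contraT => vL.
    by have := card_outputs_remove1 lL vC vL; rewrite card_eq ltnn.
  exists (vcomp v) => //; apply: contraT => vF.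
  by have := card_outputs_remove2 lL vC vF; rewrite card_eq ltnn.
have [v [v1 vc]] : exists v : vertex [:: first_layer n; L],
    vlayer v = 1 /\ vcomp v = c by apply: vertexP.
exists v; apply/existsP; exists (1%g : 'S_n); rewrite /remove v1 vc /=.
have permute1 : permute 1%g =1 @id {ffun 'I_n -> bool}.
  by move=> x; apply/ffunP => i; rewrite ffunE invg1 perm1.
rewrite (eq_imset _ permute1) imset_id; apply/eqP/eq_imset => x /=.
have lF := is_layer_first n.
rewrite -[RHS](apply_layerD1 _ lL cL) [RHS]apply_layer_id //.
  by apply: is_layerS lL; rewrite sub1set.
move=> c' /set1P->; rewrite !(apply_layerD1_out _ lL cL) /uses ?eqxx ?orbT //.
exact: apply_layer_sorted.
Qed.

(** * Labelled graphs and cancellation of a common component *)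

Definition graph_iso V1 V2 (e1 : bool -> rel V1) (e2 : bool -> rel V2) :=
  exists f : V1 -> V2, bijective f /\ forall b u v, e1 b u v = e2 b (f u) (f v).

Lemma graph_iso_sym V1 V2 (e1 : bool -> rel V1) (e2 : bool -> rel V2) :
  graph_iso e1 e2 -> graph_iso e2 e1.
Proof.
case=> f [[g gK fK] E]; exists g.
by split=> [|b u v]; [exists f | rewrite E !fK].
Qed.

Lemma graph_iso_trans V1 V2 V3 (e1 : bool -> rel V1) (e2 : bool -> rel V2)
    (e3 : bool -> rel V3) :
  graph_iso e1 e2 -> graph_iso e2 e3 -> graph_iso e1 e3.
Proof.
case=> f [bf Ef] [g [bg Eg]].
by exists (g \o f); split=> [|b u v]; [exact: bij_comp | rewrite Ef Eg].
Qed.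

(* The disjoint union with the graph of two comparators on the same pair of
   channels: both labels occur on the edge from inr false to inr true. *)
Definition add_pair V (e : bool -> rel V) : bool -> rel (V + bool)%type :=
  fun b u v => match u, v with
  | inl x, inl y => e b x y
  | inr false, inr true => true
  | _, _ => false
  end.

Lemma graph_iso_add_pair V1 V2 (e1 : bool -> rel V1) (e2 : bool -> rel V2) :
  graph_iso e1 e2 -> graph_iso (add_pair e1) (add_pair e2).
Proof.
case=> f [[g gK fK] E].
exists (fun u => match u with inl x => inl (f x) | inr b => inr b end).
split; last by move=> b [x|[]] [y|[]] //=.
by exists (fun u => match u with inl x => inl (g x) | inr b => inr b end);
  case=> [x|b] //; rewrite ?gK ?fK.
Qed.

(* An isomorphism f need not match the two added pairs.  If it sends x into the
   added pair, then x itself lies in a copy of the pair, and f sends the added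
   pair to another such copy; bypass f composes the two. *)
Definition bypass V1 V2 (f : (V1 + bool)%type -> (V2 + bool)%type) x y :=
  f (inl x) = inl y \/ exists2 b, f (inl x) = inr b & f (inr b) = inl y.

Lemma bypass_fun V1 V2 (f : (V1 + bool)%type -> (V2 + bool)%type) x y y' :
  bypass f x y -> bypass f x y' -> y = y'.
Proof.
by case=> [e|[b e e']] [d|[b' d d']]; congruence.
Qed.

Lemma bypass_sym V1 V2 (f : (V1 + bool)%type -> (V2 + bool)%type) g x y :
  cancel f g -> bypass f x y -> bypass g y x.
Proof.
move=> fK [e|[b e e']]; first by left; rewrite -e fK.
by right; exists b; rewrite -?e -?e' fK.
Qed.

(** Failure would mean that [f] sends [inl x] and both added vertices into the two-element added
    pair of the target, against injectivity. *)
Lemma bypass_total V1 V2 (e1 : bool -> rel V1) (e2 : bool -> rel V2) f x :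
  injective f ->
  (forall b u v, add_pair e1 b u v = add_pair e2 b (f u) (f v)) ->
  exists y, bypass f x y.
Proof.
move=> inj E; case fx: (f (inl x)) => [y|b]; first by exists y; left.
case fb: (f (inr b)) => [y|b']; first by exists y; right; exists b.
have neb : b <> b' by move=> bb'; move: fb; rewrite -bb' -fx => /inj.
have [b'' fnb] : exists b'', f (inr (~~ b)) = inr b''.
  (* The edge inside the added pair goes to an edge; one of its ends lands in the target pair, which
     no edge leaves or enters, so the other end lands there too. *)
  have := E true (inr false) (inr true).
  case: b {fx neb} fb => /= ->; case: (f _) => [y|b'']; try by case: b'.
    by exists b''.
  by exists b''.
have : b'' <> b by move=> e; move: fnb; rewrite e -fx => /inj.
have : b'' <> b' by move=> e; move: fnb; rewrite e -fb => /inj []; case: (b).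
by case: b'' {fnb}; case: b' {fb} neb; case: b {fx}.
Qed.

(** If exactly one of the two vertices is bypassed, both sides are false, since no edge joins an
    [inl] to an [inr]. If both are, each side equals the edge value between [inr c] and [inr c'],
    which is the same in both graphs. *)
Lemma bypass_edge V1 V2 (e1 : bool -> rel V1) (e2 : bool -> rel V2) f
    x y x' y' b :
  (forall b u v, add_pair e1 b u v = add_pair e2 b (f u) (f v)) ->
  bypass f x y -> bypass f x' y' -> e1 b x x' = e2 b y y'.
Proof.
move=> E; rewrite -[LHS]/(add_pair e1 b (inl x) (inl x')).
rewrite -[RHS]/(add_pair e2 b (inl y) (inl y')).
case=> [fx|[c fx fc]] [fx'|[c' fx' fc']].
- by rewrite E fx fx'.
- by rewrite -fx -fc' -E E fx fx'.
- by rewrite -fx' -fc -E E fx fx'; case: (c).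
- by rewrite -fc -fc' -E E fx fx'.
Qed.

(** The bypasses of [f] and of its inverse [g] are converse relations, both total and functional,
    hence mutually inverse maps. *)
Lemma graph_iso_cancel (V1 V2 : finType) (e1 : bool -> rel V1)
    (e2 : bool -> rel V2) :
  graph_iso (add_pair e1) (add_pair e2) -> graph_iso e1 e2.
Proof.
case=> f [[g fK gK] E].
have E' b u v : add_pair e2 b u v = add_pair e1 b (g u) (g v) by rewrite E !gK.
have [h hP] := fin_all_exists (fun x => bypass_total x (can_inj fK) E).
have [k kP] := fin_all_exists (fun y => bypass_total y (can_inj gK) E').
exists h; split=> [|b u v]; last exact: bypass_edge E (hP u) (hP v).
exists k => [x|y].
  exact: bypass_fun (kP _) (bypass_sym fK (hP x)).
exact: bypass_fun (hP _) (bypass_sym gK (kP y)).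
Qed.

(** Passing to [graph_iso] makes it possible to compare networks on different numbers of channels,
    and with graphs that do not come from a network. *)
Lemma net_equiv_iso n (C1 C2 : network n) :
  net_equiv C1 C2 <-> graph_iso (@edge n C1) (@edge n C2).
Proof. by split=> [/net_equivP|?]; last apply/net_equivP. Qed.

(** * Graphs of two-layer networks *)

Definition port n (b : bool) (c : comparator n) := if b then c.2 else c.1.

(** With two layers, none lies strictly between, so the blocking condition is vacuous. *)
Lemma edge_two_layer n (A L : layer n) b (u v : vertex [:: A; L]) :
  edge b u v =
  [&& vlayer u == 0, vlayer v == 1 & uses (vcomp v) (port b (vcomp u))].
Proof.
have lt2 (w : vertex [:: A; L]) : vlayer w < 2 := ltn_ord (val w).1.
rewrite /edge /port; set i := if b then _ else _.
have -> : (vlayer u < vlayer v) = (vlayer u == 0) && (vlayer v == 1).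
  by case: (vlayer u) (lt2 u) => [|[|]] //; case: (vlayer v) (lt2 v) => [|[|]].
rewrite -andbA; case: eqP => //= u0; case: eqP => //= v1; case: uses => //=.
by apply/forallP => w; rewrite u0 v1; case: (vlayer _) => [|[]].
Qed.

Lemma vertex_inj n (C : network n) (u v : vertex C) :
  vlayer u = vlayer v -> vcomp u = vcomp v -> u = v.
Proof.
case: u v => [[i c] uP] [[j d] vP]; rewrite /vlayer /vcomp /= => ij cd.
by apply: val_inj; congr pair; first exact: val_inj.
Qed.

(** * Inserting a comparator shared by both layers *)

Section InsertPair.

Variables (m : nat) (p q : 'I_m.+2).
Hypothesis pq_first : (p, q) \in first_layer m.+2.

Lemma pair_even : ~~ odd p.
Proof. by move: pq_first; rewrite first_layerE => /andP[]. Qed.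

Lemma pair_succ : q = p.+1 :> nat.
Proof. by move: pq_first; rewrite first_layerE => /andP[_ /eqP]. Qed.

Lemma shift_subproof (i : 'I_m) : (if i < p then i : nat else i.+2) < m.+2.
Proof.
by case: ifP => _; rewrite ?ltnS ?(ltn_ord i) // ltnW // ltnW // !ltnS.
Qed.

(** The increasing enumeration of the channels other than [p] and [q]. As these two are adjacent, it
    skips a single gap of length 2 and so preserves parity. *)
Definition shift (i : 'I_m) : 'I_m.+2 := Ordinal (shift_subproof i).

Lemma shift_lt i j : (shift i < shift j) = (i < j).
Proof.
rewrite /shift /=; case: (ltnP i p) => ip; case: (ltnP j p) => jp //.
  by rewrite (leq_trans ip jp) (leq_trans ip) // ltnW // ltnW.
have ji := leq_trans (ltnW jp) ip.
by rewrite ![_ < j]ltnNge ji !leqW.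
Qed.

Lemma shift_inj : injective shift.
Proof.
move=> i j ij; case: (ltngtP i j) => [lt|lt|]; last exact: val_inj.
  by have := shift_lt i j; rewrite ij lt ltnn.
by have := shift_lt j i; rewrite ij lt ltnn.
Qed.

Lemma odd_shift i : odd (shift i) = odd i.
Proof. by rewrite /=; case: ifP => //= _; rewrite negbK. Qed.

Lemma shift_neq_p i : (shift i == p) = false.
Proof.
apply/negbTE; rewrite -val_eqE /=; case: ltnP => ip; first by rewrite ltn_eqF.
by rewrite gtn_eqF // ltnS ltnW // ltnS.
Qed.

Lemma shift_neq_q i : (shift i == q) = false.
Proof.
apply/negbTE; rewrite -val_eqE /= pair_succ; case: ltnP => ip.
  by rewrite ltn_eqF // ltnW // ltnS.
by rewrite eqSS gtn_eqF // ltnS.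
Qed.

Lemma shift_onto j : j != p -> j != q -> exists i, shift i = j.
Proof.
rewrite -!val_eqE /= pair_succ => np nq; case: (ltnP j p) => [jp|pj].
  have lt : j < m.
    by apply: (leq_trans jp); have := ltn_ord q; rewrite pair_succ !ltnS.
  by exists (Ordinal lt); apply: val_inj; rewrite /= jp.
have lt1 : p.+1 < j by rewrite ltn_neqAle eq_sym nq ltn_neqAle eq_sym np.
have jE : j = j.-2.+2 :> nat by case: (val j) lt1 => [|[]].
have lt : j.-2 < m by have := ltn_ord j; rewrite {1}jE !ltnS.
exists (Ordinal lt); apply: val_inj; rewrite /= ltnNge.
by rewrite jE !ltnS in lt1; rewrite lt1.
Qed.

Definition shift_comp (c : comparator m) : comparator m.+2 :=
  (shift c.1, shift c.2).

Lemma shift_comp_inj : injective shift_comp.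
Proof.
move=> [a b] [a' b'] e.
by congr pair; apply: shift_inj;
  [exact: (congr1 fst e) | exact: (congr1 snd e)].
Qed.

Lemma uses_shift c i : uses (shift_comp c) (shift i) = uses c i.
Proof. by rewrite /uses /= !(inj_eq shift_inj). Qed.

Lemma uses_pair_shift i : uses (p, q) (shift i) = false.
Proof. by rewrite /uses /= shift_neq_p shift_neq_q. Qed.

Lemma uses_shift_pair c b : uses (shift_comp c) (port b (p, q)) = false.
Proof.
by case: b; rewrite /uses /= ![_ == shift _]eq_sym ?shift_neq_p ?shift_neq_q.
Qed.

(** Another comparator of the layer avoids [p] and [q], and every other channel is a shifted one. *)
Lemma off_pair L c : is_layer L -> (p, q) \in L -> c \in L -> c != (p, q) ->
  exists d, c = shift_comp d.
Proof.
move=> /is_layerP[_ le1] pqL cL ne.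
have away i : uses c i -> (i != p) && (i != q).
  move=> ci; apply/andP; split; apply: contraNneq ne => ie.
    by apply/eqP/(le1 i) => //; rewrite ie /uses eqxx.
  by apply/eqP/(le1 i) => //; rewrite ie /uses eqxx orbT.
have c1 : uses c c.1 by rewrite /uses eqxx.
have c2 : uses c c.2 by rewrite /uses eqxx orbT.
have /andP[p1 q1] := away c.1 c1; have /andP[p2 q2] := away c.2 c2.
have [i i1] := shift_onto p1 q1; have [j j2] := shift_onto p2 q2.
by exists (i, j); rewrite /shift_comp /= i1 j2; case: (c).
Qed.

Definition insert (L : layer m) : layer m.+2 := (p, q) |: shift_comp @: L.

Lemma insert_shift L c : (shift_comp c \in insert L) = (c \in L).
Proof.
rewrite in_setU1 (mem_imset _ _ shift_comp_inj) /= xpair_eqE shift_neq_p.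
by [].
Qed.

Lemma insert_first : insert (first_layer m) = first_layer m.+2.
Proof.
have sF c : (shift_comp c \in first_layer m.+2) = (c \in first_layer m).
  rewrite !first_layerE odd_shift; case: (boolP (odd c.1)) => //= ev.
  case: (ltnP c.1 p) => c1p; case: (ltnP c.2 p) => c2p //=.
  - have lt : c.1.+1 < p.
      (* A pair of adjacent channels starting at an even one cannot straddle the gap: its larger
         channel would be [p], which is even. *)
      rewrite ltn_neqAle c1p andbT; apply: contraNneq pair_even => <-.
      by rewrite /= ev.
    have lt2 := leq_trans lt c2p.
    by rewrite (gtn_eqF lt2) (gtn_eqF (leqW (leqW lt2))).
  have lt2 := leq_trans c2p c1p.
  by rewrite (ltn_eqF (leqW lt2)) (ltn_eqF (leqW (leqW (leqW lt2)))).
apply/setP => c; rewrite in_setU1.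
case: (eqVneq c (p, q)) => [->|ne] /=; first by rewrite pq_first.
apply/imsetP/idP => [[d dF ->]|cF]; first by rewrite sF.
have [d cd] := off_pair (is_layer_first _) pq_first cF ne.
by exists d; rewrite // -sF -cd.
Qed.

Lemma insert_layer L : is_layer L -> is_layer (insert L).
Proof.
case/is_layerP=> lt le1; apply/is_layerP; split.
  move=> c /setU1P[->|/imsetP[d /lt ltd ->]]; first by rewrite /= pair_succ.
  by rewrite shift_lt.
move=> i c c' /setU1P[->|/imsetP[d dL ->]] /setU1P[->|/imsetP[d' d'L ->]] //.
- by case/orP=> /eqP->;
    rewrite (uses_shift_pair _ false, uses_shift_pair _ true).
- by move=> use /orP[] /eqP ie; move: use; rewrite ie
    (uses_shift_pair _ false, uses_shift_pair _ true).
have useE e : uses (shift_comp e) i -> exists2 j, i = shift j & uses e j.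
  by case/orP=> /eqP->; [exists e.1 | exists e.2]; rewrite // /uses eqxx ?orbT.
case/useE=> j ij dj /useE[j' ij' d'j']; congr shift_comp.
by apply: (le1 j) => //; rewrite (_ : j = j') //; apply: shift_inj; rewrite -ij.
Qed.

Lemma insert_onto L : is_layer L -> (p, q) \in L ->
  exists2 L', is_layer L' & L = insert L'.
Proof.
move=> lL pqL; have [lt le1] := is_layerP _ lL.
exists (shift_comp @^-1: L).
  apply/is_layerP; split=> [c|i c c'].
    by rewrite inE => /lt; rewrite shift_lt.
  rewrite !inE => cL c'L ci c'i; apply: shift_comp_inj.
  by apply: (le1 (shift i)); rewrite ?uses_shift.
apply/setP => c; rewrite in_setU1.
case: (eqVneq c (p, q)) => [->|ne] /=; first by rewrite pqL.
apply/idP/imsetP => [cL|[d + ->]]; last by rewrite inE.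
have [d cd] := off_pair lL pqL cL ne.
by exists d; rewrite // inE -cd.
Qed.

Lemma insert_graph L :
  graph_iso (add_pair (@edge m [:: first_layer m; L]))
            (@edge m.+2 [:: first_layer m.+2; insert L]).
Proof.
set C := [:: first_layer m; L]; set C' := [:: _; insert L].
have nthE k : k < 2 -> nth set0 C' k = insert (nth set0 C k).
  by case: k => [|[|]] //= _; rewrite insert_first.
(* The isomorphism is first given as a relation, since a vertex carries a membership proof. The
   added vertex [inr b] corresponds to the copy of [(p, q)] in layer 0 or 1 according to [b]. *)
pose over (u : (vertex C + bool)%type) (w : vertex C') := match u with
  | inl v => vlayer w = vlayer v /\ vcomp w = shift_comp (vcomp v)
  | inr b => vlayer w = b /\ vcomp w = (p, q) end.
have over_fun u w w' : over u w -> over u w' -> w = w'.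
  by case: u => [v|b] [l c] [l' c']; apply: vertex_inj; congruence.
have over_inj u u' w : over u w -> over u' w -> u = u'.
  case: u u' => [v|b] [v'|b'] [l c] [l' c'].
  - congr inl; apply: vertex_inj; first by rewrite -l.
    by apply: shift_comp_inj; rewrite -c.
  - by move: c'; rewrite c => /(congr1 fst)/eqP; rewrite shift_neq_p.
  - by move: c'; rewrite c => /(congr1 fst)/esym/eqP; rewrite shift_neq_p.
  by congr inr; move: l'; rewrite l; case: (b); case: (b').
have over_total u : exists w, over u w.
  case: u => [v|b]; apply: vertexP.
  - exact: ltn_ord (val v).1.
  - by rewrite nthE ?insert_shift; [exact: (valP v) | exact: ltn_ord (val v).1].
  - by case: b.
  by rewrite nthE ?setU11 //; case: b.
have over_onto w : exists u, over u w.
  have lw : vlayer w < 2 := ltn_ord (val w).1.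
  have : vcomp w \in nth set0 C' (vlayer w) := valP w.
  rewrite nthE // => /setU1P[cw|/imsetP[c cC cw]].
    by exists (inr (vlayer w == 1)); split=> //; move: (vlayer w) lw => [|[]].
  have [v [vl vc]] := @vertexP _ C _ _ lw cC.
  by exists (inl v); rewrite /over vl vc.
have [f fP] := fin_all_exists over_total.
have [g gP] := fin_all_exists over_onto.
exists f; split.
  exists g => [u|w]; first exact: over_inj (gP (f u)) (fP u).
  exact: over_fun (fP _) (gP w).
move=> b u v; move: (fP u) (fP v); rewrite edge_two_layer.
case: u v => [u|c] [v|d] [-> ->] [-> ->]; rewrite /= ?edge_two_layer.
- congr [&& _, _ & _]; rewrite -uses_shift; congr uses; by case: (b).
- rewrite [port _ _](_ : _ = shift (port b (vcomp u))); last by case: (b).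
  by rewrite uses_pair_shift !andbF.
- by rewrite uses_shift_pair !andbF; case: (c).
by case: c; case: d; rewrite //= /uses /port; case: (b); rewrite eqxx ?orbT.
Qed.

End InsertPair.

(** * Counting equivalence classes *)

Lemma card_imset_eq_kernel (T U V : finType) (D : {set T})
    (f : T -> U) (g : T -> V) :
  {in D &, forall x y, f x = f y <-> g x = g y} -> #|f @: D| = #|g @: D|.
Proof.
have le (U' V' : finType) (f' : T -> U') (g' : T -> V') :
    {in D &, forall x y, f' x = f' y -> g' x = g' y} ->
    #|g' @: D| <= #|f' @: D|.
  move=> fg; have [->|[x0 x0D]] := set_0Vmem D.
    by rewrite !imset0 !cards0.
  (* [g'] factors through [f']: [h] evaluates [g'] at any preimage of [z] in [D]. The default [x0]
     never arises on the image of [f']. *)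
  pose h z := g' (odflt x0 [pick x in D | f' x == z]).
  rewrite (_ : g' @: D = h @: (f' @: D)) ?leq_imset_card // -imset_comp.
  apply: eq_in_imset => x xD; rewrite /h /=; case: pickP => [y /andP[yD /eqP]|].
    by move=> e; apply: fg.
  by move/(_ x); rewrite xD eqxx.
move=> fg; apply/eqP; rewrite eqn_leq !le // => x y xD yD;
  by case: (fg x y xD yD).
Qed.

(** [h] induces a bijection on classes. Surjectivity is asked only up to [S], because the networks
    built below reach only one position of the shared comparator. *)
Lemma card_equivalence_partition (T U : finType) (D : {set T}) (E : {set U})
    (R : rel T) (S : rel U) (h : T -> U) :
  equivalence_rel R -> equivalence_rel S ->
  {in D, forall x, h x \in E} ->
  {in D &, forall x y, S (h x) (h y) = R x y} ->
  {in E, forall y, exists2 x, x \in D & S y (h x)} ->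
  #|equivalence_partition R D| = #|equivalence_partition S E|.
Proof.
move=> eqR eqS hE hS onto.
have class_eq (W : finType) (P : rel W) (A : {set W}) : equivalence_rel P ->
    {in A &, forall x y,
      [set z in A | P x z] = [set z in A | P y z] <-> P x y}.
  move=> eqP x y xA yA; split=> [/setP/(_ y)|Pxy].
    by rewrite !inE yA /= => ->; case: (eqP y y y).
  by apply/setP => z; rewrite !inE; case: (eqP x y z) => _ ->.
(* Both partitions become images of [D] under class maps with the same kernel. *)
rewrite /equivalence_partition.
have -> : [set [set y in E | S x y] | x in E] =
    (fun x => [set y in E | S (h x) y]) @: D.
  apply/setP => B; apply/imsetP/imsetP => [[y yE ->]|[x xD ->]]; last first.
    by exists (h x); rewrite ?hE.
  have [x xD Syx] := onto y yE; exists x => //.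
  by apply/(class_eq _ _ _ eqS) => //; apply: hE.
apply: card_imset_eq_kernel => x y xD yD.
have := class_eq _ _ _ eqR x y xD yD.
have := class_eq _ _ _ eqS (h x) (h y) (hE x xD) (hE y yD).
by rewrite hS // => eS eR; apply: iff_trans eR (iff_sym eS).
Qed.

Lemma net_equiv_equivalence n k :
  equivalence_rel (fun C1 C2 : k.-tuple (layer n) => net_equiv C1 C2).
Proof.
move=> C1 C2 C3; split=> [|e12]; first exact: net_equiv_refl.
apply/idP/idP => [e13|]; last exact: net_equiv_trans.
exact: net_equiv_trans (net_equiv_sym e12) e13.
Qed.

Lemma two_layerP n (C : 2.-tuple (layer n)) :
  reflect (exists2 L, is_layer L & C = [tuple first_layer n; L])
          (C \in two_layer n).
Proof.
rewrite inE; apply: (iffP andP) => [[CN /eqP C0]|[L lL ->]]; last first.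
  by rewrite /is_network /= is_layer_first lL.
have CE : C = [tuple first_layer n; tnth C ord_max].
  apply: eq_from_tnth => -[[|[|//]] lt]; rewrite [RHS]/=.
    by rewrite -C0; congr tnth; apply: val_inj.
  by congr tnth; apply: val_inj.
exists (tnth C ord_max) => //.
by move/allP: CN; apply; apply: mem_tnth.
Qed.

Theorem theorem3 (n : nat) (hn : 2 <= n) :
  num_classes [set C in two_layer n | redundant C] = r (n - 2).
Proof.
case: n hn => [|[|m]] // _; rewrite subn2 /=.
have bottom : (ord0, inord 1) \in first_layer m.+2.
  by rewrite first_layerE /= inordK.
(* The shared comparator is always inserted on the two lowest channels. *)
pose h (C : 2.-tuple (layer m)) : 2.-tuple (layer m.+2) :=
  [tuple first_layer m.+2; insert ord0 (inord 1) (tnth C ord_max)].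
rewrite /r /num_classes; apply/esym/(card_equivalence_partition (h := h)).
- exact: net_equiv_equivalence.
- exact: net_equiv_equivalence.
- move=> _ /two_layerP[L lL ->]; have lI := insert_layer bottom lL.
  rewrite in_set; apply/andP; split.
    by apply/two_layerP; exists (insert ord0 (inord 1) L).
  rewrite redundantE //; apply/exists_inP.
  by exists (ord0, inord 1); rewrite ?setU11.
(* Cancelling the added pair gives injectivity on classes; adding it gives well-definedness. *)
- move=> _ _ /two_layerP[L lL ->] /two_layerP[L' lL' ->].
  have G := insert_graph bottom L; have G' := insert_graph bottom L'.
  apply/idP/idP => /net_equiv_iso e; apply/net_equiv_iso.
    apply: graph_iso_cancel.
    exact: graph_iso_trans G (graph_iso_trans e (graph_iso_sym G')).
  apply: graph_iso_trans (graph_iso_sym G) (graph_iso_trans _ G').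
  exact: graph_iso_add_pair.
move=> C; rewrite in_set => /andP[/two_layerP[L lL ->]].
rewrite redundantE // => /exists_inP[[p q] pqF pqL].
(* The shared [(p, q)] may lie anywhere. Deleting it and reinserting it at the bottom keeps the
   class: both graphs are that of [L'] with a pair added. *)
have [L' lL' ->] := insert_onto pqF lL pqL.
exists [tuple first_layer m; L']; first by apply/two_layerP; exists L'.
apply/net_equiv_iso.
apply: graph_iso_trans (graph_iso_sym (insert_graph pqF L')) _.
exact: insert_graph bottom L'.
Qed.
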